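(* For every integer $k\geq 2$ and every real $0<\delta\leq 1$ there exists an integer $N$ with the following property: if $n\geq N$ is a positive integer and $A$ is a subset of $[k]^n$ of density at least $\delta$, then $A$ contains a combinatorial line of $[k]^n$.
   Context: For positive integers $k,n$, $[k]=\{1,\dots,k\}$ and $[k]^n$ is the set of all sequences (words) of length $n$ with values in $[k]$. Fix a letter $v\notin[k]$. A variable word (of length $n$ over $[k]$) is a sequence of length $n$ with values in $[k]\cup\{v\}$ in which $v$ appears at least once. If $\ell$ is a variable word and $i\in[k]$, then $\ell(i)$ is the word obtained by substituting all appearances of $v$ in $\ell$ by $i$. A combinatorial line of $[k]^n$ is a set of the form $\{\ell(i): i\in[k]\}$ where $\ell$ is a variable word of length $n$ over $[k]$. The density of $A\subseteq[k]^n$ is $|A|/k^n$. *)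

(* Defs.v *)
From mathcomp Require Import all_boot all_order all_algebra.
From mathcomp Require Import reals.

Set Implicit Arguments.
Unset Strict Implicit.
Unset Printing Implicit Defensive.

Import Order.TTheory GRing.Theory Num.Theory.

(* The alphabet [k] = {1, ..., k} is encoded by 'I_k, i.e. shifted to
   {0, ..., k - 1}. *)
Definition word (k n : nat) := n.-tuple 'I_k.

(* Words over the alphabet extended by the variable letter v: [Some a] is the
   letter a and [None] is v. *)
Definition xword (k n : nat) := n.-tuple (option 'I_k).

Definition variable_word (k n : nat) (l : xword k n) : bool := None \in l.

Definition subst_word (k n : nat) (l : xword k n) (i : 'I_k) : word k n :=
  map_tuple (odflt i) l.

Definition combinatorial_line (k n : nat) (L : {set word k n}) : Prop :=
  exists2 l : xword k n,
    variable_word l & L = [set subst_word l i | i : 'I_k].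

Definition density (R : realType) (k n : nat) (A : {set word k n}) : R :=
  (#|A|%:R / k%:R ^+ n)%R.
Arguments density R {k n} A.

(* Main.v *)
(* Induction on the alphabet, from L to K = option L, after Polymath and
   Dodos-Kanellopoulos-Tyros. If DHJ fails over K, let delta > 0 be the infimum
   of the numbers bounding the densities of all line-free sets in large
   dimension. A line-free A of density almost delta in huge dimension has
   density at most slightly above delta on every large subspace, hence density
   almost delta on every section over boundedly many coordinates. DHJ over L,
   applied in such sections, produces a large subspace on which A still has
   density almost delta and on which the words x with x[None := a] in A for all
   a in L have density at least theta, with theta independent of the dimension.
   As A has no line, A misses this set D up to words avoiding None, so A has
   density larger than delta by a fixed amount relative to the complement of D.
   That complement is a union of sets insensitive to exchanging None with some
   letter a; DHJ over L allows one to tile such sets by large subspaces up to a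
   small error, and A is too dense on one of the tiles. *)
Require Import Defs.
From mathcomp Require Import all_boot all_order all_algebra.
From mathcomp Require Import reals.
From mathcomp Require boolp classical_sets.
From mathcomp Require Import ring lra.

Set Implicit Arguments.
Unset Strict Implicit.
Unset Printing Implicit Defensive.

Import Order.TTheory GRing.Theory Num.Theory.
Local Open Scope ring_scope.

(** * Averages *)

Section Averages.
Variable R : realFieldType.

(* Junk value: the average over an empty type is 0. *)
Definition avg (X : finType) (f : X -> R) : R := (\sum_x f x) / #|X|%:R.

Lemma avgE (X : finType) (f : X -> R) : avg f = (\sum_x f x) / #|X|%:R.
Proof. by []. Qed.

Lemma eq_avg (X : finType) (f g : X -> R) : f =1 g -> avg f = avg g.
Proof. by move=> fg; rewrite /avg (eq_bigr _ (fun x _ => fg x)). Qed.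

Lemma ler_avg (X : finType) (f g : X -> R) :
  (forall x, f x <= g x) -> avg f <= avg g.
Proof. by move=> fg; rewrite ler_wpM2r ?invr_ge0 ?ler0n ?ler_sum. Qed.

Lemma avgD (X : finType) (f g : X -> R) :
  avg (fun x => f x + g x) = avg f + avg g.
Proof. by rewrite /avg big_split /= mulrDl. Qed.

Lemma avgN (X : finType) (f : X -> R) : avg (fun x => - f x) = - avg f.
Proof. by rewrite /avg sumrN mulNr. Qed.

Lemma avgB (X : finType) (f g : X -> R) :
  avg (fun x => f x - g x) = avg f - avg g.
Proof. by rewrite avgD avgN. Qed.

Lemma avgZ (X : finType) (c : R) (f : X -> R) :
  avg (fun x => c * f x) = c * avg f.
Proof. by rewrite /avg -mulr_sumr mulrA. Qed.

Lemma avg_sum (X I : finType) (F : I -> X -> R) :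
  avg (fun x => \sum_i F i x) = \sum_i avg (F i).
Proof. by rewrite /avg exchange_big /= mulr_suml. Qed.

Lemma avg_exchange (X Y : finType) (F : X -> Y -> R) :
  avg (fun x => avg (F x)) = avg (fun y => avg (F^~ y)).
Proof.
rewrite /avg -!mulr_suml exchange_big /=; rewrite -!mulrA; congr (_ * _).
exact: mulrC.
Qed.

Lemma avg_pair (X Y : finType) (F : X * Y -> R) :
  avg F = avg (fun x => avg (fun y => F (x, y))).
Proof.
rewrite /avg -mulr_suml card_prod natrM invfM -mulrA [in RHS](mulrC #|Y|%:R^-1).
by congr (_ * _); rewrite pair_bigA; apply: eq_bigr => -[].
Qed.

Lemma avg_bij (X Y : finType) (h : X -> Y) (f : Y -> R) :
  bijective h -> avg (fun x => f (h x)) = avg f.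
Proof.
move=> bh; rewrite /avg (bij_eq_card bh) (reindex h) //.
exact: onW_bij.
Qed.

Lemma avg_ge0 (X : finType) (f : X -> R) : (forall x, 0 <= f x) -> 0 <= avg f.
Proof. by move=> f0; rewrite divr_ge0 ?ler0n ?sumr_ge0. Qed.

Section NonEmpty.
Variables (X : finType) (X0 : (0 < #|X|)%N).

Let cX : #|X|%:R != 0 :> R. Proof. by rewrite pnatr_eq0 -lt0n. Qed.

Lemma avg_const (c : R) : avg (fun _ : X => c) = c.
Proof. by rewrite /avg sumr_const -[c *+ _]mulr_natr mulfK. Qed.

Lemma avg_le (f : X -> R) (c : R) : (forall x, f x <= c) -> avg f <= c.
Proof. by move=> fc; rewrite -[leRHS]avg_const ler_avg. Qed.

Lemma avg_witness (f : X -> R) : exists x, avg f <= f x.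
Proof.
apply/existsP; case: existsP => //= no; exfalso.
have lt x : f x < avg f by rewrite ltNge; apply/negP => fx; apply: no; exists x.
have: \sum_x f x < \sum_(x : X) avg f.
  by apply: ltr_sum => //; have /card_gt0P[x _] := X0; apply/hasP; exists x;
     rewrite ?mem_index_enum.
by rewrite sumr_const -[avg f *+ _]mulr_natr /avg mulfVK ?ltxx.
Qed.

Lemma avg_ge_term (f : X -> R) (x : X) :
  (forall y, 0 <= f y) -> f x / #|X|%:R <= avg f.
Proof.
move=> f0; rewrite ler_wpM2r ?invr_ge0 ?ler0n // (bigD1 x) //= lerDl.
by apply: sumr_ge0.
Qed.

(** The deficits [u - f y] are nonnegative, so a single one is at most their sum, which is [#|X|]
    times the average deficit. *)
Lemma avg_lower (f : X -> R) (u c : R) (x : X) :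
  (forall y, f y <= u) -> u - c <= avg f -> u - #|X|%:R * c <= f x.
Proof.
move=> fu af.
have H : u - f x <= (u - avg f) * #|X|%:R.
  rewrite -ler_pdivrMr ?ltr0n // -[u in u - avg f]avg_const -avgB.
  by apply: (@avg_ge_term (fun y => u - f y)) => y; rewrite subr_ge0.
have : (u - avg f) * #|X|%:R <= c * #|X|%:R.
  by rewrite ler_wpM2r ?ler0n //; lra.
by rewrite mulrC (mulrC c); lra.
Qed.

(** Reverse Markov inequality: since [f <= 1], the difference [f x - c] is pointwise at most the
    indicator of [c <= f x]. *)
Lemma avg_markov (f : X -> R) (c : R) : (forall x, f x <= 1) -> 0 <= c ->
  avg f - c <= avg (fun x => (c <= f x)%R%:R).
Proof.
move=> f1 c0; rewrite -[in leLHS](avg_const c) -avgB; apply: ler_avg => x.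
have := f1 x; case: (lerP c (f x)) => /=; lra.
Qed.

End NonEmpty.
End Averages.

(** * Words and subspaces *)

Lemma card_bij (X Y : finType) : #|X| = #|Y| -> exists h : X -> Y, bijective h.
Proof.
move=> e; exists (fun x => enum_val (cast_ord e (enum_rank x))).
exists (fun y => enum_val (cast_ord (esym e) (enum_rank y))) => x;
  by rewrite enum_valK ?cast_ordK ?cast_ordKV enum_rankK.
Qed.

Section Words.
Variable L : finType.
Implicit Types T M N P S : finType.

(* A word [w] over [L + M] in which every variable of [M] occurs is a
   combinatorial subspace with coordinates indexed by [M]. *)
Definition app T M (w : {ffun T -> L + M}) (x : {ffun M -> L}) : {ffun T -> L} :=
  [ffun t => match w t with inl a => a | inr j => x j end].

Definition full T M (w : {ffun T -> L + M}) : bool :=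
  [forall j, exists t, w t == inr j].

Definition tcomp T M N (w : {ffun T -> L + M}) (v : {ffun M -> L + N}) :
    {ffun T -> L + N} :=
  [ffun t => match w t with inl a => inl a | inr j => v j end].

(** [None] is the variable. The same type holds the words over the alphabet [option L], so a word
    there in which [None] occurs is also a variable word over [L]. *)
Definition sub T (l : {ffun T -> option L}) (a : L) : {ffun T -> L} :=
  [ffun t => odflt a (l t)].

Definition has_line T (A : {ffun T -> L} -> bool) : Prop :=
  exists2 l : {ffun T -> option L}, exists t, l t = None
    & forall a, A (sub l a).

Definition join P S (x : {ffun P -> L}) (y : {ffun S -> L}) : {ffun P + S -> L} :=
  [ffun t => match t with inl p => x p | inr s => y s end].

(** Sections over fixed coordinates are presented as subspaces, so that hypotheses on all subspaces
    apply to them. *)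
Definition lfree P S (y : {ffun S -> L}) : {ffun P + S -> L + P} :=
  [ffun t => match t with inl p => inr p | inr s => inl (y s) end].

Definition rfree P S (x : {ffun P -> L}) : {ffun P + S -> L + S} :=
  [ffun t => match t with inl p => inl (x p) | inr s => inr s end].

Definition free_at T (J : pred T) (x : {ffun T -> L}) : {ffun T -> L + {t | J t}} :=
  [ffun t => if insub t is Some j then inr j else inl (x t)].

Lemma fullP T M (w : {ffun T -> L + M}) :
  reflect (forall j, exists t, w t = inr j) (full w).
Proof.
apply: (iffP forallP) => H j.
  by have /existsP[t /eqP] := H j; exists t.
by have [t wt] := H j; apply/existsP; exists t; rewrite wt.
Qed.

Lemma app_lfree P S (x : {ffun P -> L}) (y : {ffun S -> L}) :
  app (lfree P y) x = join x y.
Proof. by apply/ffunP => -[p|s]; rewrite !ffunE. Qed.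

Lemma app_rfree P S (x : {ffun P -> L}) (y : {ffun S -> L}) :
  app (rfree S x) y = join x y.
Proof. by apply/ffunP => -[p|s]; rewrite !ffunE. Qed.

Lemma full_lfree P S (y : {ffun S -> L}) : full (lfree P y).
Proof. by apply/fullP => p; exists (inl p); rewrite ffunE. Qed.

Lemma full_rfree P S (x : {ffun P -> L}) : full (rfree S x).
Proof. by apply/fullP => s; exists (inr s); rewrite ffunE. Qed.

Lemma full_free_at T (J : pred T) (x : {ffun T -> L}) : full (free_at J x).
Proof. by apply/fullP => j; exists (val j); rewrite ffunE valK. Qed.

Lemma app_comp T M N (w : {ffun T -> L + M}) (v : {ffun M -> L + N}) x :
  app (tcomp w v) x = app w (app v x).
Proof. by apply/ffunP => t; rewrite !ffunE; case: (w t) => // j; rewrite ffunE. Qed.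

Lemma full_comp T M N (w : {ffun T -> L + M}) (v : {ffun M -> L + N}) :
  full w -> full v -> full (tcomp w v).
Proof.
move=> /fullP fw /fullP fv; apply/fullP => j.
by have [i vi] := fv j; have [t wt] := fw i; exists t; rewrite ffunE wt.
Qed.

Lemma app_inj T M (w : {ffun T -> L + M}) : full w -> injective (app w).
Proof.
move=> /fullP fw x y /ffunP xy; apply/ffunP => j.
by have [t wt] := fw j; have := xy t; rewrite !ffunE wt.
Qed.

Lemma has_line_app T M (w : {ffun T -> L + M}) (A : {ffun T -> L} -> bool) :
  full w -> has_line (fun x => A (app w x)) -> has_line A.
Proof.
move=> /fullP fw [l [j lj] Al].
exists [ffun t => match w t with inl a => Some a | inr j => l j end].
  by have [t wt] := fw j; exists t; rewrite ffunE wt.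
move=> a; have := Al a; congr A.
by apply/ffunP => t; rewrite !ffunE; case: (w t) => // i; rewrite ffunE.
Qed.

Lemma card_word_gt0 T : (0 < #|L|)%N -> (0 < #|{ffun T -> L}|)%N.
Proof. by move=> L0; rewrite card_ffun expn_gt0 L0. Qed.

Variable R : realFieldType.

Lemma avg_join P S (f : {ffun P + S -> L} -> R) :
  avg f = avg (fun x => avg (fun y => f (join x y))).
Proof.
pose h (z : {ffun P -> L} * {ffun S -> L}) := join z.1 z.2.
rewrite -(avg_pair (fun z => f (h z))) (@avg_bij _ _ _ h) //.
exists (fun w : {ffun P + S -> L} => ([ffun p => w (inl p)], [ffun s => w (inr s)])).
  by move=> [x y]; congr (_, _); apply/ffunP => t; rewrite !ffunE.
by move=> w; apply/ffunP => -[p|s]; rewrite !ffunE.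
Qed.

Lemma avg_reindex (T T' : finType) (h : T -> T') (f : {ffun T -> L} -> R) :
  bijective h -> avg (fun x : {ffun T' -> L} => f [ffun t => x (h t)]) = avg f.
Proof.
case=> g gh hg; apply: avg_bij; exists (fun x : {ffun T -> L} => [ffun t => x (g t)]).
  by move=> x; apply/ffunP => t; rewrite !ffunE hg.
by move=> x; apply/ffunP => t; rewrite !ffunE gh.
Qed.

(** Separates a bounded block [P] from the remaining coordinates [S]. The word [b] only renames
    coordinates, hence preserves averages. *)
Lemma split_coords T P (n : nat) : (#|P| + n <= #|T|)%N ->
  exists2 S : finType, (n <= #|S|)%N &
  exists2 b : {ffun T -> L + (P + S)}, full b
    & forall f : {ffun T -> L} -> R, avg (fun x => f (app b x)) = avg f.
Proof.
move=> le; exists 'I_(#|T| - #|P|); first by rewrite card_ord leq_subRL //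
  (leq_trans _ le) // leq_addr.
have [|h hbij] := @card_bij T (P + 'I_(#|T| - #|P|))%type.
  by rewrite card_sum card_ord subnKC // (leq_trans _ le) // leq_addr.
exists [ffun t => inr (h t)].
  by apply/fullP => j; case: hbij => g _ hg; exists (g j); rewrite ffunE hg.
move=> f; rewrite -(avg_reindex f hbij); apply: eq_avg => x; congr f.
by apply/ffunP => t; rewrite !ffunE.
Qed.

(** Resampling the coordinates in [J] keeps the uniform distribution: exchanging [x] on [J] with [v]
    is an involution on pairs. *)
Lemma avg_free_at T (J : pred T) (F : {ffun T -> L} -> R) : (0 < #|L|)%N ->
  avg F = avg (fun x => avg (fun v => F (app (free_at J x) v))).
Proof.
move=> L0; pose h (z : {ffun T -> L} * {ffun {t | J t} -> L}) :=
  (app (free_at J z.1) z.2, [ffun j => z.1 (val j)]) : {ffun T -> L} * {ffun {t | J t} -> L}.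
have hK : involutive h.
  move=> [x v]; congr (_, _); apply/ffunP => t; rewrite !ffunE ?valK //=.
  case: insubP => [j _ <-|nJ]; rewrite ?ffunE //.
rewrite -(avg_pair (fun z => F (h z).1)) (avg_bij (fun z => F z.1) (inv_bij hK)).
by rewrite avg_pair; apply: eq_avg => x /=; rewrite avg_const ?card_word_gt0.
Qed.

End Words.

Definition DHJ (R : realFieldType) (L : finType) : Prop :=
  forall d : R, 0 < d -> exists N : nat, forall T : finType, (N <= #|T|)%N ->
  forall A : {ffun T -> L} -> bool, d <= avg (fun x => (A x)%:R) -> has_line A.

(** * Words over the smaller alphabet and insensitive sets *)

Section Embed.
Variable L : finType.
Implicit Types T M : finType.

Definition embed T (z : {ffun T -> L}) : {ffun T -> option L} :=
  [ffun t => Some (z t)].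

Definition collapse T (a : L) (x : {ffun T -> option L}) : {ffun T -> option L} :=
  embed (sub x a).

(** Equivalently, [D] is invariant under exchanging [None] and [a] at any positions: words differing
    in this way have the same collapse. *)
Definition insensitive T (a : L) (D : {ffun T -> option L} -> bool) : Prop :=
  forall x, D (collapse a x) = D x.

Lemma collapse_app T M (w : {ffun T -> option L + M}) a x :
  collapse a (app w (collapse a x)) = collapse a (app w x).
Proof.
by apply/ffunP => t; rewrite !ffunE; case: (w t) => // j; rewrite !ffunE.
Qed.

Lemma insensitive_app T M (w : {ffun T -> option L + M}) a D :
  insensitive a D -> insensitive a (fun x => D (app w x)).
Proof. by move=> iD x; rewrite -iD collapse_app iD. Qed.

End Embed.

(** * Subspaces over the smaller alphabet in dense sets *)

Lemma geometric_small (R : realType) (q e : R) : 0 <= q -> q < 1 -> 0 < e ->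
  exists N : nat, forall n : nat, (N <= n)%N -> q ^+ n < e.
Proof.
move=> q0 q1 e0.
(* A form of Bernoulli's inequality without division by [q]. *)
have bern n : q ^+ n * (1 + n%:R * (1 - q)) <= 1.
  elim: n => [|n IH]; first by rewrite expr0 mul0r addr0 mulr1.
  apply: le_trans IH; rewrite exprSr -mulrA ler_wpM2l ?exprn_ge0 //.
  rewrite -natr1; have := ler0n R n; move: (n%:R) => y y0.
  have : 0 <= (y + 1) * (1 - q) ^+ 2 by rewrite mulr_ge0 ?sqr_ge0 ?addr_ge0.
  lra.
pose N := Num.bound (e^-1 / (1 - q)).
have Nb : e^-1 < N%:R * (1 - q).
  by rewrite -ltr_pdivrMr ?subr_gt0 // archi_boundP // divr_ge0 ?invr_ge0 ?ltW ?subr_gt0.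
have qN : q ^+ N < e.
  have N1 : e^-1 < 1 + N%:R * (1 - q) by lra.
  have d0 : 0 < 1 + N%:R * (1 - q) by apply: lt_trans N1; rewrite invr_gt0.
  apply: (@le_lt_trans _ _ (1 + N%:R * (1 - q))^-1).
    by rewrite -[leRHS]mul1r ler_pdivlMr.
  by rewrite -[ltRHS]invrK ltf_pV2 // posrE invr_gt0.
exists N => n le; apply: le_lt_trans qN.
by apply: ler_wiXn2l; rewrite // ltW.
Qed.

Section EmbeddedLine.
Variables (L : finType) (T : finType).

Definition support (x : {ffun T -> option L}) : {set T} := [set t | x t != None].

Definition none_off (J : {set T}) : {ffun T -> option L + {t | t \in J}} :=
  free_at (fun t => t \in J) [ffun=> None].

Lemma full_none_off J : full (none_off J).
Proof. exact: full_free_at. Qed.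

Lemma sum_support (R : realFieldType) (J : {set T}) (F : {ffun T -> option L} -> R) :
  (0 < #|L|)%N ->
  \sum_(x | support x == J) F x =
  \sum_(z : {ffun {t | t \in J} -> L}) F (app (none_off J) (embed z)).
Proof.
move=> /card_gt0P[a0 _].
pose h' (x : {ffun T -> option L}) : {ffun {t | t \in J} -> L} :=
  [ffun j => odflt a0 (x (val j))].
rewrite (reindex_onto (fun z => app (none_off J) (embed z)) h') /=; last first.
  move=> x /eqP sx; apply/ffunP => t; rewrite !ffunE.
  have := in_set (fun t => x t != None) t; rewrite -/(support x) sx.
  case: insubP => [j tJ <-|tJ]; last by rewrite (negbTE (tJ : t \notin J)); case: (x t).
  by rewrite !ffunE (valP j : _ \in J); case: (x _).
apply: eq_bigl => z; apply/andP; split; apply/eqP.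
  apply/setP => t; rewrite inE !ffunE.
  case: insubP => [j tJ _|tJ]; last by rewrite (negbTE (tJ : t \notin J)).
  by rewrite (tJ : t \in J) ffunE.
by apply/ffunP => j; rewrite !ffunE valK !ffunE.
Qed.

(** The sum factors over the coordinates: [None] contributes 1 and each letter of [L] contributes
    1/2. This weight serves to bound the number of words with small support. *)
Lemma sum_half_support (R : realFieldType) :
  \sum_(x : {ffun T -> option L}) 2%:R^-1 ^+ #|support x|
  = (1 + #|L|%:R / 2%:R) ^+ #|T| :> R.
Proof.
pose g (o : option L) : R := if o is Some _ then 2%:R^-1 else 1.
have -> : 1 + #|L|%:R / 2%:R = \sum_o g o.
  rewrite (bigD1 None) //=; congr (_ + _).
  rewrite (reindex_omap (@Some L) id) /=; last by case.
  by rewrite big_mkcond /= (eq_bigr (fun=> 2%:R^-1)) ?sumr_const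
    ?mulr_natl // => a _; rewrite eqxx.
rewrite -prodr_const bigA_distr_bigA /=; apply: eq_bigr => x _.
rewrite -prodr_const big_mkcond /=; apply: eq_bigr => t _.
by rewrite inE /g; case: (x t).
Qed.

End EmbeddedLine.

(* Conditionally on its support, a random word over [option L] is a random word
   over [L] on the support, which is large with high probability. *)
Lemma dense_embedded_line (R : realType) (L : finType) (d : R) :
  (0 < #|L|)%N -> DHJ R L -> 0 < d ->
  exists N : nat, forall T : finType, (N <= #|T|)%N ->
  forall D : {ffun T -> option L} -> bool, d <= avg (fun x => (D x)%:R) ->
  exists2 w : {ffun T -> option L + unit}, full w
    & forall z : {ffun unit -> L}, D (app w (embed z)).
Proof.
move=> L0 dhj d0; have d20 : 0 < d / 2%:R by lra.
have [m mP] := dhj _ d20.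
pose k : R := #|L|%:R.
have k1 : 1 <= k by rewrite ler1n.
(* By [sum_half_support], [q ^+ #|T|] is the average of [2%:R^-1 ^+ #|support x|]. *)
pose q : R := (1 + k / 2%:R) / (1 + k).
have q0 : 0 <= q by rewrite /q; apply: divr_ge0; lra.
have q1 : q < 1 by rewrite /q ltr_pdivrMr; lra.
have e0 : 0 < d / 2%:R / 2%:R ^+ m by rewrite divr_gt0 // exprn_gt0.
have [N NP] := geometric_small q0 q1 e0.
exists N => T leN D dD.
pose AJ (J : {set T}) := avg (fun z : {ffun {t | t \in J} -> L} =>
  (D (app (none_off L J) (embed z)))%:R) : R.
case: (boolP [exists J : {set T}, (m <= #|J|)%N && (d / 2%:R <= AJ J)]).
  case/existsP=> J /andP[mJ dJ].
  have [|l [j lj] Dl] := mP _ _ _ dJ; first by rewrite card_sig.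
  pose v : {ffun {t | t \in J} -> option L + unit} :=
    [ffun j => if l j is Some a then inl (Some a) else inr tt].
  exists (tcomp (none_off L J) v).
    apply: full_comp (full_none_off _ _) _; apply/fullP => -[]; exists j.
    by rewrite ffunE lj.
  move=> z; have := Dl (z tt); rewrite app_comp; congr (D (app _ _)).
  by apply/ffunP => i; rewrite !ffunE; case: (l i) => [a|]; rewrite ?ffunE.
rewrite negb_exists => /forallP no; exfalso.
pose n := #|T|.
have cK : #|{ffun T -> option L}|%:R = (1 + k) ^+ n :> R.
  by rewrite card_ffun card_option natrX -natr1 addrC.
have cK0 : 0 < (1 + k) ^+ n :> R by rewrite exprn_gt0 //; lra.
(* The first term covers supports of size at least [m]; on smaller ones the second term is at least
   1. *)
have bound (J : {set T}) : \sum_(x | support x == J) (D x)%:R <=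
  \sum_(x : {ffun T -> option L} | support x == J)
     (d / 2%:R + 2%:R ^+ m * 2%:R^-1 ^+ #|support x|) :> R.
  have [mJ|mJ] := leqP m #|J|.
    have := no J; rewrite mJ /= -ltNge => /ltW; rewrite /AJ avgE.
    rewrite ler_pdivrMr ?ltr0n ?card_word_gt0 // => le.
    rewrite big_split /= ler_wpDr //.
      by apply: sumr_ge0 => x _; rewrite mulr_ge0 ?exprn_ge0 ?invr_ge0.
    rewrite !sum_support //; apply: le_trans le _.
    by rewrite sumr_const -[_ *+ #|_|]mulr_natr.
  apply: ler_sum => x /eqP sx.
  apply: (@le_trans _ _ 1); first by case: (D x).
  rewrite sx exprVn ler_wpDl ?(ltW d20) // ler_pdivlMr ?exprn_gt0 // mul1r.
  by rewrite ler_weXn2l ?ler1n // ltnW.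
have tot : \sum_x (D x)%:R <=
  \sum_(x : {ffun T -> option L}) (d / 2%:R + 2%:R ^+ m * 2%:R^-1 ^+ #|support x|) :> R.
  rewrite (partition_big (@support L T) predT) //=.
  rewrite [leRHS](partition_big (@support L T) predT) //=.
  by apply: ler_sum => J _; apply: bound.
move: tot; rewrite big_split /= sumr_const -mulr_sumr sum_half_support.
rewrite -[_ *+ #|_|]mulr_natr cK -/n -/k => tot.
have small := NP n leN.
have qn : (1 + k / 2%:R) ^+ n = q ^+ n * (1 + k) ^+ n.
  by rewrite -exprMn mulfVK // gt_eqF //; lra.
move: dD; rewrite avgE cK ler_pdivlMr // => dD.
have m0 : 0 < 2%:R ^+ m :> R by rewrite exprn_gt0.
have := le_trans dD tot; rewrite qn mulrA -mulrDl ler_pM2r // => ge.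
move: small; rewrite ltr_pdivlMr // mulrC; lra.
Qed.

Lemma avg_pigeonhole (R : realFieldType) (W Y : finType) (p : Y -> bool)
    (g : W -> Y -> bool) : (0 < #|W|)%N ->
  (forall y, p y -> exists w, g w y) ->
  exists w, avg (fun y => (p y)%:R) / #|W|%:R <= avg (fun y => (g w y)%:R) :> R.
Proof.
move=> W0 pg; have [w le] := avg_witness W0 (fun w => avg (fun y => (g w y)%:R) : R).
exists w; apply: le_trans le; rewrite [leRHS]avgE -avg_sum.
rewrite ler_wpM2r ?invr_ge0 ?ler0n // ler_avg // => y.
case py: (p y); last by rewrite sumr_ge0.
have [v gv] := pg y py; rewrite (bigD1 v) //= gv lerDl.
by rewrite sumr_ge0.
Qed.

Lemma option_gt0 (L : finType) : (0 < #|{: option L}|)%N.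
Proof. by rewrite card_option. Qed.

(** By reverse Markov, a proportion at least [d / 2] of the sections have density at least [d / 2],
    hence contain a subspace. There are finitely many candidates [w], so one of them serves a fixed
    proportion of the sections. *)
Lemma section_subspace (R : realFieldType) (L P S M : finType) (d : R)
    (D : {ffun P + S -> option L} -> bool) : 0 < d ->
  (forall E : {ffun P -> option L} -> bool, d / 2%:R <= avg (fun x => (E x)%:R) ->
   exists2 w : {ffun P -> option L + M}, full w & forall z, E (app w (embed z))) ->
  d <= avg (fun x => (D x)%:R) ->
  exists2 w : {ffun P -> option L + M}, full w &
  d / 2%:R / #|{ffun P -> option L + M}|%:R <=
  avg (fun y => [forall z, D (join (app w (embed z)) y)]%:R).
Proof.
move=> d0 EP dD; pose W := {ffun P -> option L + M}.
have W0 : (0 < #|{: W}|)%N.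
  by rewrite card_ffun expn_gt0 card_sum card_option.
have S0 := card_word_gt0 S (option_gt0 L).
pose dens y := avg (fun x => (D (join x y))%:R) : R.
have [||w] := @avg_pigeonhole R W _ (fun y => d / 2%:R <= dens y)
  (fun w y => full w && [forall z, D (join (app w (embed z)) y)]) => //.
  move=> y /EP[w fw Dw]; exists w; rewrite fw; apply/forallP => z; exact: Dw.
move=> le; have {le} : d / 2%:R / #|W|%:R <=
    avg (fun y => (full w && [forall z, D (join (app w (embed z)) y)])%:R).
  apply: le_trans le; rewrite ler_wpM2r ?invr_ge0 ?ler0n //.
  have := @avg_markov R _ S0 dens (d / 2%:R); rewrite /dens => H.
  have {H} : avg dens - d / 2%:R <= avg (fun y => (d / 2%:R <= dens y)%R%:R).
    apply: H; last by lra.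
    move=> y; apply: avg_le; first exact: card_word_gt0 (option_gt0 L).
    by move=> x; case: (D _).
  rewrite /dens avg_exchange -(avg_join (fun x => (D x)%:R)) => H.
  by apply: le_trans H; lra.
(* For a [w] that is not full the average would vanish, against the positive lower bound. *)
case: (boolP (full w)) => [fw le|_]; first by exists w.
move=> /=; rewrite avg_const // leNgt divr_gt0 ?ltr0n // ?divr_gt0 //.
Qed.

(** Induction on the dimension: a subspace on a bounded block is common to a dense set of tails, and
    an embedded line in that set supplies one more variable. [M] is fixed before [d] because the
    density drops along the induction. *)
Lemma dense_embedded_subspace (R : realType) (L : finType) (m : nat) :
  (0 < #|L|)%N -> DHJ R L ->
  exists2 M : finType, (m <= #|M|)%N & forall d : R, 0 < d ->
  exists N : nat, forall T : finType, (N <= #|T|)%N ->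
  forall D : {ffun T -> option L} -> bool, d <= avg (fun x => (D x)%:R) ->
  exists2 w : {ffun T -> option L + M}, full w & forall z, D (app w (embed z)).
Proof.
move=> L0 dhj; elim: m => [|m [M mM IH]].
  exists void => // d d0; exists 0%N => T _ D dD.
  have [x Dx] := avg_witness (card_word_gt0 T (option_gt0 L)) (fun x => (D x)%:R : R).
  have {}Dx : D x.
    by have := lt_le_trans d0 (le_trans dD Dx); case: (D x); rewrite // ltxx.
  exists [ffun t => inl (x t)]; first by apply/fullP => -[].
  by move=> z; congr D: Dx; apply/ffunP => t; rewrite !ffunE.
exists (M + unit)%type; first by rewrite card_sum card_unit addn1.
move=> d d0; have [n nP] := IH _ (divr_gt0 d0 (ltr0n R 2)).
pose W := {ffun 'I_n -> option L + M}.
have k0 : 0 < d / 2%:R / #|{: W}|%:R.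
  rewrite divr_gt0 ?ltr0n // ?divr_gt0 //.
  by rewrite card_ffun expn_gt0 card_sum card_option.
have [N NP] := dense_embedded_line L0 dhj k0.
exists (n + N)%N => T leT D dD.
have [|S leS [b fb avgb]] := @split_coords (option L) R T 'I_n N.
  by rewrite card_ord.
have [|||w fw] := @section_subspace R L 'I_n S M d (fun x => D (app b x)) => //.
- by move=> E; apply: nP; rewrite card_ord.
- by rewrite (avgb (fun x => (D x)%:R)).
move=> /(NP S leS)[u fu Du].
pose v : {ffun 'I_n + S -> option L + (M + unit)} := [ffun t => match t with
  | inl p => match w p with inl a => inl a | inr j => inr (inl j) end
  | inr s => match u s with inl a => inl a | inr j => inr (inr j) end end].
exists (tcomp b v).
  apply: full_comp fb _; apply/fullP => -[j|j].
    by have /fullP/(_ j)[p wp] := fw; exists (inl p); rewrite ffunE wp.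
  by have /fullP/(_ j)[s us] := fu; exists (inr s); rewrite ffunE us.
move=> z; have /forallP/(_ [ffun j => z (inl j)]) := Du [ffun j => z (inr j)].
rewrite app_comp; congr (D (app _ _)); apply/ffunP => -[p|s]; rewrite !ffunE.
  by case: (w p) => // j; rewrite !ffunE.
by case: (u s) => // j; rewrite !ffunE.
Qed.

(** * Insensitive sets *)

(* [D] is exhausted, up to [e], by disjoint subspaces: as long as [D] is dense,
   many of its sections contain a common subspace [V], and removing [V] from the
   sections lying in the insensitive set [B] of those containing it leaves
   insensitive fibers of total density smaller by a fixed factor. *)
Lemma insensitive_bound (R : realType) (L : finType) (m : nat) (e : R) :
  (0 < #|L|)%N -> DHJ R L -> 0 < e ->
  exists N : nat, forall T : finType, (N <= #|T|)%N ->
  forall (a : L) (D : {ffun T -> option L} -> bool) (f : {ffun T -> option L} -> R),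
  insensitive a D -> (forall x, f x <= 1) ->
  (forall M : finType, (m <= #|M|)%N -> forall w : {ffun T -> option L + M},
    full w -> avg (fun x => f (app w x)) <= 0) ->
  avg (fun x => f x * (D x)%:R) <= e.
Proof.
move=> L0 dhj e0; pose beta := e / 2%:R; have beta0 : 0 < beta by rewrite divr_gt0.
have [M mM MP] := dense_embedded_subspace m L0 dhj.
have [n nP] := MP _ (divr_gt0 beta0 (ltr0n R 2)).
pose X := {ffun 'I_n -> option L}; pose W := {ffun 'I_n -> option L + M}.
have X0 : (0 < #|{: X}|)%N := card_word_gt0 'I_n (option_gt0 L).
have cX0 : 0 < #|{: X}|%:R :> R by rewrite ltr0n.
have W0 : 0 < #|{: W}|%:R :> R.
  by rewrite ltr0n card_ffun expn_gt0 card_sum card_option.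
(* Density removed in one round: [B] has at least the density given by [section_subspace], and [V]
   has at least one of the [#|X|] words. *)
pose kappa := beta / 2%:R / #|{: W}|%:R / #|{: X}|%:R.
have kappa0 : 0 < kappa by rewrite !divr_gt0.
pose q := (1 + kappa)^-1.
have k1 : 0 < 1 + kappa by lra.
have q0 : 0 < q by rewrite invr_gt0.
have q1 : q < 1 by rewrite invf_lt1 //; lra.
(* Each of the [s] rounds uses up [n] coordinates; unless [D] is already sparse, it shrinks the
   remaining density by the factor [q]. *)
have claim s : forall T : finType, (s * n <= #|T|)%N ->
    forall (a : L) (D : {ffun T -> option L} -> bool) (f : {ffun T -> option L} -> R),
    insensitive a D -> (forall x, f x <= 1) ->
    (forall N : finType, (m <= #|N|)%N -> forall w : {ffun T -> option L + N},
      full w -> avg (fun x => f (app w x)) <= 0) ->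
    avg (fun x => f x * (D x)%:R) <= beta + q ^+ s * avg (fun x => (D x)%:R).
  elim: s => [|s IH] T leT a D f iD f1 fV.
    rewrite expr0 mul1r ler_wpDl ?(ltW beta0) // ler_avg // => x.
    by case: (D x); rewrite ?mulr1 ?mulr0.
  have D0 : 0 <= avg (fun x => (D x)%:R : R) by apply: avg_ge0.
  have [sparse|/ltW dense] := leP (avg (fun x => (D x)%:R : R)) beta.
    apply: ler_wpDr; first by rewrite mulr_ge0 // exprn_ge0 // ltW.
    apply: le_trans sparse; apply: ler_avg => x.
    by case: (D x); rewrite ?mulr1 ?mulr0.
  have [|S leS [b fb avgb]] := @split_coords (option L) R T 'I_n (s * n).
    by rewrite card_ord.
  pose g x := f (app b x); pose E x := D (app b x).
  have Y0 := card_word_gt0 S (option_gt0 L).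
  have gV (N : finType) (w : {ffun 'I_n + S -> option L + N}) : (m <= #|N|)%N -> full w ->
      avg (fun x => g (app w x)) <= 0.
    move=> mN fw; have := fV N mN _ (full_comp fb fw).
    by under eq_avg do rewrite app_comp.
  have iE : insensitive a E := insensitive_app b iD.
  have [|||w fw densB] := @section_subspace R L 'I_n S M beta E => //.
  - by move=> F; apply: nP; rewrite card_ord.
  - by rewrite (avgb (fun x => (D x)%:R)).
  pose B y := [forall z, E (join (app w (embed z)) y)].
  pose V x := [exists v, app w v == x].
  rewrite -/B in densB.
  (* [B] tests only the points of [w] over [L]; insensitivity of [E] extends this to all its points,
     through their collapses. *)
  have VB x y : V x -> B y -> E (join x y).
    move=> /existsP[v /eqP <-] /forallP /(_ (sub v a)).
    rewrite -!app_lfree -(insensitive_app _ iE) /=.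
    rewrite -[E (app _ (app w v))](insensitive_app _ iE) /=.
    by rewrite -/(collapse a v) collapse_app.
  (* [V] need not be insensitive, so insensitivity is kept only at fixed [x]; the induction
     hypothesis is applied fiber by fiber. *)
  pose E' x y := E (join x y) && ~~ (V x && B y).
  have iB : insensitive a B.
    move=> y; apply: eq_forallb => z; rewrite -!app_rfree.
    exact: (insensitive_app _ iE).
  have iE' x : insensitive a (E' x).
    by move=> y; rewrite /E' iB -!app_rfree (insensitive_app _ iE).
  have avgV F : avg (fun v => F (app w v)) <= 0 ->
      avg (fun x => F x * (V x)%:R) <= 0 :> R.
    rewrite !avgE; rewrite ler_pdivrMr ?ltr0n ?card_word_gt0 ?card_option // mul0r.
    move=> sum0; rewrite ler_pdivrMr // mul0r; apply: le_trans sum0.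
    rewrite -(big_imset _ (in2W (app_inj fw) : {in predT &, injective (app w)})) /=.
    rewrite [leRHS]big_mkcond /=; apply: ler_sum => x _; rewrite /V.
    case: imsetP => [[v _ xv]|no]; case: existsP => [[v' /eqP xv']|no'] /=; rewrite ?mulr1 ?mulr0 //.
      by case: no'; exists v; rewrite xv.
    by case: no; exists v'.
  have splitE x y : (E (join x y))%:R = (E' x y)%:R + (V x)%:R * (B y)%:R :> R.
    rewrite /E'; have := VB x y; case: (V x); case: (B y) => /= H;
    rewrite ?andbT ?andbF ?mulr0 ?mul0r ?addr0 ?add0r ?mulr1 //.
    by rewrite H.
  have densE' : avg (fun x => avg (fun y => (E' x y)%:R)) <=
      avg (fun x => (D x)%:R) - kappa :> R.
    have -> : avg (fun x => (D x)%:R) = avg (fun x => avg (fun y => (E (join x y))%:R)) :> R.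
      by rewrite -(avg_join (fun x => (E x)%:R)) (avgb (fun x => (D x)%:R)).
    under [in leRHS]eq_avg do under eq_avg do rewrite splitE.
    under [in leRHS]eq_avg do rewrite avgD avgZ.
    rewrite avgD -addrA lerDl subr_ge0.
    under [in leRHS]eq_avg do rewrite mulrC.
    rewrite avgZ /kappa ler_pM //.
      by rewrite ltW // !divr_gt0.
      by rewrite invr_ge0 ler0n.
    have /card_gt0P[v0 _] := card_word_gt0 M (option_gt0 L).
    have := @avg_ge_term R _ (fun x => (V x)%:R) (app w v0) (fun=> ler0n _ _).
    suff -> : V (app w v0) by rewrite mul1r.
    by apply/existsP; exists v0.
  have -> : avg (fun x => f x * (D x)%:R) =
      avg (fun x => avg (fun y => g (join x y) * (E' x y)%:R)) +
      avg (fun y => (B y)%:R * avg (fun x => g (join x y) * (V x)%:R)).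
    rewrite -(avgb (fun x => f x * (D x)%:R)) avg_join.
    under [X in _ = _ + X]eq_avg do rewrite -avgZ.
    rewrite [X in _ = _ + X]avg_exchange -avgD; apply: eq_avg => x.
    by rewrite -avgD; apply: eq_avg => y; rewrite -/(E _) splitE /g; ring.
  have le2 : avg (fun y => (B y)%:R * avg (fun x => g (join x y) * (V x)%:R)) <= 0.
    apply: avg_le => // y; case: (B y); rewrite ?mul0r // mul1r.
    apply: (avgV (fun x => g (join x y))).
    under eq_avg do rewrite -app_lfree -app_comp.
    by apply: gV; rewrite // full_comp // full_lfree.
  have le1 : avg (fun x => avg (fun y => g (join x y) * (E' x y)%:R)) <=
      avg (fun x => beta + q ^+ s * avg (fun y => (E' x y)%:R)).
    apply: ler_avg => x; apply: (IH S leS a) => //.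
      by move=> y; apply: f1.
    move=> N mN v fv; under eq_avg do rewrite -app_rfree -app_comp.
    by apply: gV; rewrite // full_comp // full_rfree.
  rewrite avgD avg_const // avgZ in le1.
  rewrite -[leRHS]addr0 lerD //; apply: le_trans le1 _.
  rewrite lerD2l exprSr -mulrA ler_wpM2l ?exprn_ge0 ?(ltW q0) //.
  rewrite /q mulrC ler_pdivlMr //.
  (* If [r] is the remaining density, [r <= 1] and the loss of [kappa] show that [(1 + kappa) * r]
     is at most the density of [D]. *)
  have le1' : avg (fun x => avg (fun y => (E' x y)%:R)) <= 1 :> R.
    by apply: avg_le => // x; apply: avg_le => // y; case: (E' x y).
  have := ler_piMl (ltW kappa0) le1'.
  rewrite mulrDr mulr1; lra.
have [s sP] := geometric_small (ltW q0) q1 beta0.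
exists (s * n)%N => T leT a D f iD f1 fV.
apply: le_trans (claim s T leT a D f iD f1 fV) _.
have D1 : avg (fun x => (D x)%:R) <= 1 :> R.
  by apply: avg_le; [exact: card_word_gt0 (option_gt0 L) | move=> x; case: (D x)].
have := ler_piMr (exprn_ge0 s (ltW q0)) D1; have := sP s (leqnn s).
rewrite /beta; lra.
Qed.

(** Induction on [s]: the complement of the first set is treated directly, and the rest of the union
    is restricted to the insensitive set [D a]. *)
Lemma insensitive_union_bound (R : realType) (L : finType) (s : seq L) :
  (0 < #|L|)%N -> DHJ R L -> forall (m : nat) (e : R), 0 < e ->
  exists N : nat, forall T : finType, (N <= #|T|)%N ->
  forall (D : L -> {ffun T -> option L} -> bool) (f : {ffun T -> option L} -> R),
  (forall a, insensitive a (D a)) -> (forall x, f x <= 1) ->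
  (forall M : finType, (m <= #|M|)%N -> forall w : {ffun T -> option L + M},
    full w -> avg (fun x => f (app w x)) <= 0) ->
  avg (fun x => f x * (~~ all (D^~ x) s)%:R) <= e.
Proof.
move=> L0 dhj; elim: s => [|a s IH] m e e0.
  exists 0%N => T _ D f _ _ _; rewrite (@eq_avg _ _ _ (fun=> 0)).
    by rewrite avg_const ?ltW // card_word_gt0 ?option_gt0.
  by move=> x; rewrite mulr0.
have e30 : 0 < e / 3%:R by rewrite divr_gt0.
have [N1 N1P] := insensitive_bound m L0 dhj e30.
have [N2 N2P] := IH m _ e30.
have [N3 N3P] := insensitive_bound N2 L0 dhj e30.
exists (maxn N1 N3) => T; rewrite geq_max => /andP[le1 le3] D f iD f1 fV.
pose G x := f x * (~~ all (D^~ x) s)%:R.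
(* By induction inside each subspace of dimension at least [N2], [G] averages at most [e / 3] there;
   the shift makes these averages nonpositive. *)
pose g x := G x - e / 3%:R.
have -> : avg (fun x => f x * (~~ all (D^~ x) (a :: s))%:R) =
    avg (fun x => f x * (~~ D a x)%:R) + avg (fun x => g x * (D a x)%:R)
    + e / 3%:R * avg (fun x => (D a x)%:R).
  rewrite -avgZ -!avgD; apply: eq_avg => x; rewrite /g /G /=.
  by case: (D a x) => /=; ring.
have b1 : avg (fun x => f x * (~~ D a x)%:R) <= e / 3%:R.
  by apply: (N1P T le1 a (fun x => ~~ D a x)) => // x; congr (~~ _); apply: iD.
have b2 : avg (fun x => g x * (D a x)%:R) <= e / 3%:R.
  apply: (N3P T le3 a (D a)) => // [x|M leM w fw].
    have := f1 x; rewrite /g /G; case: (~~ _); rewrite ?mulr1 ?mulr0; lra.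
  rewrite /g avgB avg_const ?card_word_gt0 ?option_gt0 // subr_le0.
  apply: (N2P M leM (fun b x => D b (app w x)) (fun x => f (app w x))) => //.
    by move=> b; apply: insensitive_app.
  move=> M' leM' w' fw'; under eq_avg do rewrite -app_comp.
  by apply: fV => //; apply: full_comp.
have b3 : avg (fun x => (D a x)%:R) <= 1 :> R.
  by apply: avg_le; [exact: card_word_gt0 (option_gt0 L) | move=> x; case: (D a x)].
have := ler_piMr (ltW e30) b3; lra.
Qed.

(** * The critical density *)

Definition line_free_bound (R : realFieldType) (L : finType) (c : R) : Prop :=
  exists N : nat, forall T : finType, (N <= #|T|)%N ->
  forall A : {ffun T -> L} -> bool, ~ has_line A -> avg (fun x => (A x)%:R) <= c.

(** [delta] is the infimum of the valid bounds. Were it 0, line-free sets would have arbitrarily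
    small density in large dimension, which is DHJ. *)
Lemma critical_density (R : realType) (L : finType) : (0 < #|L|)%N -> ~ DHJ R L ->
  exists2 delta : R, 0 < delta & forall eta : R, 0 < eta ->
    line_free_bound L (delta + eta) /\ ~ line_free_bound L (delta - eta).
Proof.
move=> L0 nDHJ; pose E : classical_sets.set R := fun c => line_free_bound L c.
have E1 : E 1.
  exists 0%N => T _ A _; apply: avg_le; first exact: card_word_gt0.
  by move=> x; case: (A x).
have E_ge0 c : E c -> 0 <= c.
  case=> N NP; have := NP 'I_N _ (fun=> false).
  rewrite card_ord avg_const ?card_word_gt0 // => -> //.
  by have /card_gt0P[a _] := L0; case=> l _ /(_ a).
have lbE : classical_sets.has_lbound E by exists 0 => c /E_ge0.
have infE : classical_sets.has_inf E by split; first by exists 1.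
have up eta : 0 < eta -> line_free_bound L (inf E + eta).
  move=> eta0; have [c [N NP] lt] := inf_adherent eta0 infE.
  exists N => T leT A nA; exact: le_trans (NP T leT A nA) (ltW lt).
have inf_ge0 : 0 <= inf E by apply: lb_le_inf; [exists 1 | move=> c /E_ge0].
exists (inf E).
  rewrite lt_neqAle inf_ge0 andbT; apply/eqP => inf0; apply: nDHJ => d d0.
  have [|N NP] := up (d / 2%:R); first by rewrite divr_gt0.
  exists N => T leT A dA; apply: boolp.contrapT => nA; have := NP T leT A nA.
  rewrite -inf0; lra.
move=> eta eta0; split; first exact: up.
by move=> bnd; have := ge_inf lbE bnd; lra.
Qed.

(** Block [i] of [x] is read as a word with variable [None], for which the letter [u i] is
    substituted. *)
Definition plug (L I M : finType) (x : {ffun I * M -> option L}) (u : {ffun I -> L}) :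
  {ffun I * M -> option L} := [ffun p => Some (odflt (u p.1) (x p))].

(** Along the line [l], only the blocks where [l] has its variable depend on [a], and there plugging
    is collapsing. *)
Lemma plug_line (L I M : finType) (l : {ffun I -> option L})
    (x : {ffun I * M -> option L}) (v : {ffun {p | l p.1 == None} -> option L}) (a a0 : L) :
  plug (app (free_at (fun p => l p.1 == None) x) v) (sub l a) =
  app (free_at (fun p => l p.1 == None) (plug x (sub l a0))) (collapse a v).
Proof.
apply/ffunP => p; rewrite !ffunE; case: insubP => [j /eqP lj _|].
  by rewrite !ffunE lj.
by rewrite ?ffunE; case: (l p.1).
Qed.

(* Near the critical density every section of [A] over a bounded number of
   coordinates still has density almost [delta]. Fill [m] blocks of
   coordinates with independent random words: plugging the words over [L] of
   length [m] into them yields, for a random tail, a dense set of words, hence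
   a line, and one line [l] serves a positive proportion of the choices. The
   blocks where [l] has its variable span the desired subspace. *)
Lemma dense_line_set (R : realType) (L : finType) (delta : R) :
  (0 < #|L|)%N -> DHJ R L -> 0 < delta ->
  (forall eta : R, 0 < eta -> line_free_bound (option L) (delta + eta) /\
     ~ line_free_bound (option L) (delta - eta)) ->
  exists2 theta : R, 0 < theta & forall (N : nat) (e : R), 0 < e ->
  exists2 T : finType, (N <= #|T|)%N &
  exists2 A : {ffun T -> option L} -> bool, ~ has_line A &
    delta - e <= avg (fun x => (A x)%:R) /\
    theta <= avg (fun x => [forall a, A (collapse a x)]%:R).
Proof.
move=> L0 dhj delta0 crit.
have [|m mP] := dhj (delta / 4%:R); first by rewrite divr_gt0.
pose W := {ffun 'I_m -> option L}.
have W0 : (0 < #|{: W}|)%N := card_word_gt0 'I_m (option_gt0 L).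
pose theta := delta / 4%:R / #|{: W}|%:R.
have theta0 : 0 < theta by rewrite !divr_gt0 ?ltr0n.
exists (theta / 2%:R); first by rewrite divr_gt0.
move=> N e e0; pose c := e / 2%:R; have c0 : 0 < c by rewrite divr_gt0.
have ct0 : 0 < c * theta / 8%:R by rewrite divr_gt0 // mulr_gt0.
have [[n1 n1P] _] := crit _ ct0.
pose M := maxn N n1; pose P := ('I_m * 'I_M)%type; pose X := {ffun P -> option L}.
have X0 : (0 < #|{: X}|)%N := card_word_gt0 P (option_gt0 L).
pose eta' := Num.min (c * theta / 8%:R) (Num.min (e / 2%:R) (delta / 2%:R)).
have eta'0 : 0 < eta' by rewrite !lt_min ct0 !divr_gt0.
have [eta'1 eta'2 eta'3] : [/\ eta' <= c * theta / 8%:R, eta' <= e / 2%:R & eta' <= delta / 2%:R].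
  by rewrite /eta' !ge_min !lexx !orbT.
(* The gap between the upper bound [delta + eta] and the mean is at most [2 * eta], and [avg_lower]
   multiplies it by [#|X|]. *)
pose eta := eta' / #|{: X}|%:R / 2%:R.
have eta0 : 0 < eta by rewrite !divr_gt0 ?ltr0n.
have [[n2 n2P] low] := crit _ eta0.
have [T0 [leT0 [A0 [nA0 dA0]]]] : exists T : finType, (#|{: P}| + n2 <= #|T|)%N /\
    exists A : {ffun T -> option L} -> bool,
    ~ has_line A /\ delta - eta < avg (fun x => (A x)%:R).
  apply: boolp.contrapT => no; apply: low; exists (#|{: P}| + n2)%N => T leT A nA.
  rewrite leNgt; apply/negP => lt; apply: no.
  by exists T; split=> //; exists A; split.
have [S leS [b fb avgb]] := @split_coords (option L) R T0 P n2 leT0.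
pose A z := A0 (app b z).
have nA : ~ has_line A by move/has_line_app => /(_ fb).
have Y0 := card_word_gt0 S (option_gt0 L).
pose sec (x : X) := avg (fun y => (A (join x y))%:R) : R.
have sec_le x : sec x <= delta + eta.
  apply: (n2P S leS (fun y => A (join x y))) => hl; apply: nA.
  apply: (has_line_app (full_rfree S x)); case: hl => l hl Al; exists l => // a.
  by rewrite app_rfree.
have sec_ge x : delta - eta' <= sec x.
  have := @avg_lower R _ X0 sec (delta + eta) (2%:R * eta) x sec_le.
  rewrite /sec -(avg_join (fun x => (A x)%:R)) (avgb (fun x => (A0 x)%:R)) -/(sec x).
  have -> : #|{: X}|%:R * (2%:R * eta) = eta'.
    by rewrite /eta; field; rewrite pnatr_eq0 -lt0n.
  move=> /(_ _)H; have {}H := H ltac:(lra); lra.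
pose good (l : W) (z : X * {ffun S -> option L}) :=
  [exists i, l i == None] && [forall a, A (join (plug z.1 (sub l a)) z.2)].
pose dens (x : X) y := avg (fun u => (A (join (plug x u) y))%:R) : R.
have [l gl] : exists l, theta <= avg (fun z => (good l z)%:R).
  have [||l le] := @avg_pigeonhole R W _ (fun z => delta / 4%:R <= dens z.1 z.2) good => //.
    move=> [x y] /= /mP[|l [i li] Al]; first by rewrite card_ord.
    exists l; apply/andP; split; first by apply/existsP; exists i; rewrite li.
    by apply/forallP => a; apply: Al.
  exists l; apply: le_trans le; rewrite ler_wpM2r ?invr_ge0 ?ler0n //.
  rewrite avg_pair /= -[leLHS](avg_const X0); apply: ler_avg => x.
  have d1 y : dens x y <= 1.
    by apply: avg_le => [|u]; [exact: card_word_gt0 | case: (A _)].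
  have d40 : 0 <= delta / 4%:R by rewrite divr_ge0 ?ltW.
  apply: le_trans (avg_markov Y0 d1 d40).
  (* Each [plug x u] is itself a point of [X], so its section is dense; the Markov loss [delta / 4]
     then leaves at least [delta / 4]. *)
  have : avg (fun _ : {ffun 'I_m -> L} => delta - eta') <= avg (dens x).
    rewrite /dens avg_exchange; apply: ler_avg => u; exact: sec_ge.
  rewrite avg_const ?card_word_gt0 //; lra.
have [i0 li0] : exists i, l i == None.
  apply/existsP; case: (boolP [exists i, _]) => // no; move: gl.
  have -> : avg (fun z => (good l z)%:R) = avg (fun _ : X * {ffun S -> option L} => 0) :> R.
    by apply: eq_avg => z; rewrite /good (negbTE no).
  by rewrite avg_const ?card_prod ?muln_gt0 ?X0 ?Y0 // leNgt theta0.
have /card_gt0P[a0 _] := L0.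
pose J := [pred p : P | l p.1 == None]; pose w x := free_at J (plug x (sub l a0)).
pose B x y v := A (join (app (w x) v) y).
pose G x y v := [forall a, B x y (collapse a v)].
have avgG : theta <= avg (fun x => avg (fun y => avg (fun v => (G x y v)%:R))).
  apply: le_trans gl _; rewrite avg_pair (avg_free_at J) ?option_gt0 //.
  apply: ler_avg => x; rewrite avg_exchange; apply: ler_avg => y; apply: ler_avg => v.
  rewrite /good /G /B /=; case: [exists _, _] => //=; rewrite ler_nat.
  apply/eq_leq; congr nat_of_bool; apply: eq_forallb => a.
  by rewrite (plug_line _ _ _ a0).
have cJ : (M <= #|{: {p | J p}}|)%N.
  rewrite -[M in (M <= _)%N]card_ord.
  pose h (i : 'I_M) : {p | J p} := exist (fun p => is_true (J p)) (i0, i) li0.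
  by apply: (@leq_card _ _ h) => i j [].
have cX : forall f : X -> R, (forall x, delta - eta' <= f x) -> delta - eta' <= avg f.
  by move=> f fx; rewrite -[leLHS](avg_const X0); apply: ler_avg.
have avgB : delta - eta' <= avg (fun x => avg (fun y => avg (fun v => (B x y v)%:R))).
  apply: cX => x; rewrite avg_exchange.
  rewrite -[leLHS](avg_const (card_word_gt0 {p | J p} (option_gt0 L))).
  by apply: ler_avg => v; apply: sec_ge.
(* [x] and [y] are chosen for the combined average: [B] cannot much exceed [delta], so [G] is large,
   and [G <= 1] with small weight [c] keeps [B] near [delta]. *)
have [x lex] := avg_witness X0 (fun x => avg (fun y => avg (fun v => (B x y v)%:R)
   + c * avg (fun v => (G x y v)%:R)) : R).
have [y ley] := avg_witness Y0 (fun y => avg (fun v => (B x y v)%:R)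
   + c * avg (fun v => (G x y v)%:R) : R).
have {lex ley} le := le_trans lex ley.
have {}le : delta - eta' + c * theta <=
    avg (fun v => (B x y v)%:R) + c * avg (fun v => (G x y v)%:R).
  apply: le_trans le; under [leRHS]eq_avg do rewrite avgD avgZ.
  by rewrite avgD avgZ lerD // ler_wpM2l // ltW.
have nB : ~ has_line (B x y).
  move=> hl; apply: nA.
  have /has_line_app : full (tcomp (lfree P y) (w x)).
    by apply: full_comp; [exact: full_lfree | exact: full_free_at].
  apply; case: hl => l' hl Bl; exists l' => // a.
  by rewrite app_comp app_lfree; apply: Bl.
exists {p | J p}; first by apply: leq_trans cJ; apply: leq_maxl.
exists (B x y) => //.
have Bup : avg (fun v => (B x y v)%:R) <= delta + c * theta / 8%:R.
  by apply: n1P => //; apply: leq_trans cJ; apply: leq_maxr.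
have G1 : avg (fun v => (G x y v)%:R) <= 1 :> R.
  by apply: avg_le; [exact: card_word_gt0 (option_gt0 L) | move=> v; case: (G x y v)].
have cG := ler_piMr (ltW c0) G1.
have ct := mulr_gt0 c0 theta0.
split; first by move: cG; rewrite /c in le ct *; lra.
rewrite -(ler_pM2l c0) -/(G x y); lra.
Qed.

(** * The induction on the alphabet *)

Lemma avg_full_support (R : realFieldType) (L T : finType) : (0 < #|L|)%N ->
  avg (fun x : {ffun T -> option L} => (support x == [set: T])%:R)
  = (#|L|%:R / #|L|.+1%:R) ^+ #|T| :> R.
Proof.
move=> L0; rewrite avgE.
rewrite (eq_bigr (fun x => if support x == [set: T] then 1 else 0)); last first.
  by move=> x _; case: eqP.
rewrite -big_mkcond sum_support // sumr_const card_ffun card_sig card_ffun card_option.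
by rewrite cardsT !natrX expr_div_n.
Qed.

(* Otherwise [x], read as a variable word with variable [None], is a line in [A]. *)
Lemma line_free_full_support (L T : finType) (A : {ffun T -> option L} -> bool) x :
  ~ has_line A -> A x -> (forall a, A (collapse a x)) -> support x = [set: T].
Proof.
move=> nA Ax Acx; apply/setP => t; rewrite !inE; apply/eqP => xt; apply: nA.
exists [ffun t => if x t is Some a then Some (Some a) else None].
  by exists t; rewrite ffunE xt.
move=> [a|].
  by have := Acx a; congr A; apply/ffunP => s; rewrite !ffunE; case: (x s).
by move: Ax; congr A; apply/ffunP => s; rewrite !ffunE; case: (x s).
Qed.

Lemma DHJ_option (R : realType) (L : finType) :
  (0 < #|L|)%N -> DHJ R L -> DHJ R (option L).
Proof.
move=> L0 dhj; apply: boolp.contrapT => nDHJ.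
have [delta delta0 crit] := critical_density (option_gt0 L) nDHJ.
have [theta theta0 rich] := dense_line_set L0 dhj delta0 crit.
have dt0 : 0 < delta * theta by rewrite mulr_gt0.
have g0 : 0 < delta * theta / 4%:R by rewrite divr_gt0.
have e0 : 0 < delta * theta / 8%:R by rewrite divr_gt0.
have [[m mP] _] := crit _ g0.
have [N1 N1P] := insensitive_union_bound (enum L) L0 dhj m g0.
have [||N2 N2P] := @geometric_small R (#|L|%:R / #|L|.+1%:R) _ _ _ e0.
- by rewrite divr_ge0.
- by rewrite ltr_pdivrMr ?mul1r ?ltr_nat ?ltr0n.
have [T leT [A nA [dA dD]]] := rich (maxn N1 N2) _ e0.
move: leT; rewrite geq_max => /andP[leT1 leT2].
have Y0 := card_word_gt0 T (option_gt0 L).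
pose D x := [forall a, A (collapse a x)].
pose c := delta + delta * theta / 4%:R.
pose f x : R := (A x)%:R - c.
have small : avg (fun x => (A x)%:R * (D x)%:R) <= delta * theta / 8%:R.
  apply: ltW; apply: le_lt_trans (N2P _ leT2); rewrite -avg_full_support //.
  apply: ler_avg => x; case Ax: (A x); last by rewrite mul0r.
  rewrite mul1r; case: (boolP (D x)) => // /forallP Dx.
  by rewrite (line_free_full_support nA Ax Dx) eqxx.
have large : avg (fun x => f x * (~~ D x)%:R) <= delta * theta / 4%:R.
  have := N1P T leT1 (fun a x => A (collapse a x)) f.
  have -> : avg (fun x => f x * (~~ all (fun a => A (collapse a x)) (enum L))%:R)
    = avg (fun x => f x * (~~ D x)%:R).
    apply: eq_avg => x; congr (_ * (~~ _)%:R).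
    apply/allP/forallP => [H a|H a _]; last exact: H.
    by apply: H; rewrite mem_enum.
  apply.
  - by move=> a x; congr A; apply/ffunP => t; rewrite !ffunE.
  - move=> x; have : 0 <= c by rewrite addr_ge0 // ltW.
    by rewrite /f; case: (A x) => /=; lra.
  - move=> M leM w fw; rewrite /f avgB avg_const ?card_word_gt0 ?option_gt0 //.
    rewrite subr_le0; apply: mP => // hl; apply: nA; exact: has_line_app fw hl.
(* Off [D] the total excess of [A] over [c] is at least [delta * theta / 2], contradicting
   [large]. *)
have : avg (fun x => f x * (~~ D x)%:R) =
    avg (fun x => (A x)%:R) - avg (fun x => (A x)%:R * (D x)%:R)
    - c * (1 - avg (fun x => (D x)%:R)).
  rewrite -[X in _ * (X - _)](avg_const Y0) -!avgB -avgZ -avgB; apply: eq_avg => x.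
  by rewrite /f; case: (D x) => /=; ring.
have cD : c * (1 - avg (fun x => (D x)%:R)) <= c * (1 - theta).
  by rewrite ler_wpM2l ?lerB ?addr_ge0 // ltW.
have : 0 < delta * theta / 4%:R * theta by rewrite mulr_gt0.
move: cD; rewrite /c; move: small large dA => *; lra.
Qed.

(** * Renaming of letters, the induction on their number, and the passage to tuples *)

Lemma DHJ_bij (R : realFieldType) (L L' : finType) (h : L -> L') :
  bijective h -> DHJ R L -> DHJ R L'.
Proof.
move=> [g hK gK] dhj d d0; have [N NP] := dhj d d0; exists N => T leT A dA.
pose H (x : {ffun T -> L}) : {ffun T -> L'} := [ffun t => h (x t)].
have Hbij : bijective H.
  by exists (fun y : {ffun T -> L'} => [ffun t => g (y t)]) => x; apply/ffunP => t; rewrite !ffunE ?hK ?gK.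
have [|l [t lt] Al] := NP T leT (fun x => A (H x)).
  by rewrite (avg_bij (fun x => (A x)%:R) Hbij).
exists [ffun t => omap h (l t)]; first by exists t; rewrite ffunE lt.
move=> a; have := Al (g a); congr A; apply/ffunP => s; rewrite !ffunE.
by case: (l s) => //=; rewrite gK.
Qed.

Lemma DHJ_ord (R : realType) (k : nat) : DHJ R 'I_k.+1.
Proof.
elim: k => [|k IH]; last first.
  have [|h hbij] := @card_bij (option 'I_k.+1) 'I_k.+2; first by rewrite card_option !card_ord.
  by apply: DHJ_bij hbij _; apply: DHJ_option IH; rewrite card_ord.
(* Over one letter the only word is itself a line, provided there is a coordinate to carry the
   variable. *)
move=> d d0; exists 1%N => T /card_gt0P[t _] A dA.
have [|x] := @avg_witness R _ _ (fun x => (A x)%:R); first by rewrite card_word_gt0 ?card_ord.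
move=> /(le_trans dA) /(lt_le_trans d0); rewrite ltr0n lt0b => Ax.
exists [ffun=> None]; first by exists t; rewrite ffunE.
by move=> a; move: Ax; congr A; apply/ffunP => s; rewrite !ffunE !ord1.
Qed.

Theorem theorem1 (R : realType) (k : nat) (delta : R) :
  (2 <= k)%N -> 0 < delta -> delta <= 1 ->
  exists N : nat, forall n : nat, (0 < n)%N -> (N <= n)%N ->
    forall A : {set word k n}, delta <= density R A ->
      exists2 L : {set word k n}, combinatorial_line L & L \subset A.
Proof.
case: k => // k _ delta0 _; have [N NP] := DHJ_ord k delta0.
exists N => n _ leN A dA.
pose tup (x : {ffun 'I_n -> 'I_k.+1}) : word k.+1 n := [tuple x i | i < n].
have tup_bij : bijective tup.
  exists (fun u : word k.+1 n => [ffun i => tnth u i]) => u.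
    by apply/ffunP => i; rewrite ffunE tnth_mktuple.
  by apply: eq_from_tnth => i; rewrite tnth_mktuple ffunE.
have [||l [i li] Al] := NP 'I_n _ (fun x => tup x \in A); first by rewrite card_ord.
  rewrite (avg_bij (fun u => (u \in A)%:R) tup_bij) avgE card_tuple card_ord natrX.
  rewrite (eq_bigr (fun u => if u \in A then 1 else 0)) -?big_mkcond ?sumr_const //.
  by move=> u _; case: (u \in A).
exists [set subst_word [tuple l i | i < n] a | a : 'I_k.+1].
  exists [tuple l i | i < n] => //.
  by rewrite /variable_word -li; apply/tnthP; exists i; rewrite tnth_mktuple.
apply/subsetP => _ /imsetP[a _ ->].
suff -> : subst_word [tuple l i | i < n] a = tup (sub l a) by exact: Al.
by apply: eq_from_tnth => j; rewrite tnth_map !tnth_mktuple ffunE.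
Qed.
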